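(* Let $\lambda$ be a partition of $2n$ and write $m_j$ for the multiplicity of $j$ in $\lambda$. Suppose $m_j$ is even whenever $j$ is odd. The $G$-orbits in $\mathcal{O}_\lambda(k)$ are parametrized by $n$-tuples $$\overline{\mathcal{Q}}=(\mathcal{Q}_2,\mathcal{Q}_4,\ldots,\mathcal{Q}_{2n}),$$ where $\mathcal{Q}_j$ represents the isometry class of a nondegenerate quadratic form over $k$ of dimension $m_j$ (taking $\mathcal{Q}_j=0$ if $m_j=0$).
   Context: $k$ is a non-Archimedean local field (with finite residue field) of odd residual characteristic, and of characteristic $0$ or of characteristic $p>3(2n-1)$; $K$ is an algebraic closure of $k$; $n\ge2$. With $J=\begin{pmatrix}0&I\\-I&0\end{pmatrix}$, $I$ the $n\times n$ identity matrix, and $\dagger$ denoting transpose, $\mathrm{Sp}_{2n}(K)=\{g\in \mathrm{GL}_{2n}(K):g^\dagger Jg=J\}$, $G=\mathrm{Sp}_{2n}(k)$ is its group of $k$-rational points, and $\mathfrak{g}=\mathfrak{sp}_{2n}(k)$ is the Lie algebra of $G$, on which $G$ acts by the adjoint action (conjugation). $\mathcal{O}_\lambda$ is the nilpotent adjoint $\mathrm{Sp}_{2n}(K)$-orbit in $\mathfrak{sp}_{2n}(K)$ attached to $\lambda$, i.e. the orbit of nilpotent elements whose Jordan block sizes are the parts of $\lambda$, and $\mathcal{O}_\lambda(k)=\mathcal{O}_\lambda\cap\mathfrak{g}$ is its set of $k$-rational points. ''Parametrized by'' means in one-to-one correspondence with. *)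

(* Defs.v *)
From HB Require Import structures.
From mathcomp Require Import all_boot all_order all_algebra.
From mathcomp Require Import boolp classical_sets functions.

Set Implicit Arguments.
Unset Strict Implicit.
Unset Printing Implicit Defensive.

Import Order.TTheory GRing.Theory Num.Theory.
Local Open Scope classical_set_scope.
Local Open Scope ring_scope.

(* "v x >= N" with the convention v 0 = +oo; the value of v at 0 is never
   used. *)
Definition val_ge (k : fieldType) (v : k -> int) (x : k) (N : int) : bool :=
  (x == 0) || (N <= v x).

(* k is complete for the normalized discrete valuation v, with finite residue
   field: the ring of integers is [val_ge v _ 0], its maximal ideal is
   [val_ge v _ 1], and finitely many elements represent all its residues. *)
Record nonarch_local_field (k : fieldType) (v : k -> int) : Prop := {
  valM : forall x y, x != 0 -> y != 0 -> v (x * y) = v x + v y;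
  valD : forall x y, x != 0 -> y != 0 -> x + y != 0 ->
    Num.min (v x) (v y) <= v (x + y);
  val_normalized : exists2 x, x != 0 & v x = 1;
  val_complete : forall u : nat -> k,
    (forall N, exists M, forall i j,
       (M <= i)%N -> (M <= j)%N -> val_ge v (u i - u j) N) ->
    exists l, forall N, exists M, forall i,
      (M <= i)%N -> val_ge v (u i - l) N;
  residue_finite : exists s : seq k,
    forall x, val_ge v x 0 -> exists2 y, y \in s & val_ge v (x - y) 1
}.

(* p%:R vanishes in the residue field. *)
Definition residual_pchar (k : fieldType) (v : k -> int) (p : nat) : Prop :=
  prime p /\ val_ge v p%:R 1.

Definition is_algebraic_closure (k : fieldType) (K : closedFieldType)
    (iota : {rmorphism k -> K}) : Prop :=
  forall x : K, algebraicOver iota x.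

Section Symplectic.
Variables (F : fieldType) (n : nat).

Definition Jmx : 'M[F]_(n + n) := block_mx 0 1%:M (- 1%:M) 0.

Definition Sp : set 'M[F]_(n + n) :=
  [set g | g \in unitmx /\ g^T *m Jmx *m g = Jmx].

Definition sp : set 'M[F]_(n + n) :=
  [set X | X^T *m Jmx + Jmx *m X = 0].

Definition Ad_orbit (X : 'M[F]_(n + n)) : set 'M[F]_(n + n) :=
  [set Y | exists2 g, Sp g & Y = g *m X *m invmx g].

End Symplectic.

Definition is_partition (la : seq nat) (m : nat) : Prop :=
  [/\ sorted geq la, 0%N \notin la & sumn la = m].

Definition mult (la : seq nat) (j : nat) : nat := count_mem j la.

Definition nilp_jordan_block (F : fieldType) (d : nat) : 'M[F]_d :=
  \matrix_(i < d, j < d) ((j == i.+1 :> nat)%:R).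

Definition nilp_jordan_mx (F : fieldType) (la : seq nat) :
    'M[F]_(\sum_(i < size la) nth 0%N la i) :=
  \mxdiag_(i < size la) nilp_jordan_block F (nth 0%N la i).

(* P is a priori rectangular, which avoids a cast along m = \sum_i la_i: being
   row-free and row-full, it is an invertible change of basis. *)
Definition nilp_jordan_type (F : fieldType) (m : nat) (X : 'M[F]_m)
    (la : seq nat) : Prop :=
  exists P : 'M[F]_(m, \sum_(i < size la) nth 0%N la i),
    [/\ row_free P, row_full P & X *m P = P *m nilp_jordan_mx F la].

Definition nilp_orbit (K : closedFieldType) (n : nat) (la : seq nat) :
    set 'M[K]_(n + n) :=
  [set X | sp X /\ nilp_jordan_type X la].

Definition rational_nilp_orbit (k : fieldType) (K : closedFieldType)
    (iota : {rmorphism k -> K}) (n : nat) (la : seq nat) :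
    set 'M[k]_(n + n) :=
  [set X | sp X /\ nilp_orbit la (map_mx iota X)].

Definition rational_orbits (k : fieldType) (K : closedFieldType)
    (iota : {rmorphism k -> K}) (n : nat) (la : seq nat) :
    set (set 'M[k]_(n + n)) :=
  [set Ad_orbit X | X in rational_nilp_orbit iota la].

Section QuadraticForms.
Variables (F : fieldType) (m : nat).
Implicit Types q : 'rV[F]_m -> F.

Definition polar q (x y : 'rV[F]_m) : F := q (x + y) - q x - q y.

(* The polar form is symmetric, so linearity in one argument is enough. *)
Definition quadratic_form q : Prop :=
  (forall a x, q (a *: x) = a ^+ 2 * q x) /\
  (forall y, scalar (polar q ^~ y)).

Definition nondeg_form q : Prop :=
  forall x, (forall y, polar q x y = 0) -> x = 0.

Definition isometric q q' : Prop :=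
  exists2 P : 'M[F]_m, P \in unitmx & forall x, q' (x *m P) = q x.

Definition isometry_class q : set ('rV[F]_m -> F) :=
  [set q' | quadratic_form q' /\ isometric q q'].

Definition nondeg_isometry_classes : set (set ('rV[F]_m -> F)) :=
  [set isometry_class q | q in
     [set q | quadratic_form q /\ nondeg_form q]].

End QuadraticForms.

(* Component i : 'I_n is Q_j for j = 2(i + 1). If m_j = 0 it is the class of
   the zero form on the zero space, the only form of dimension 0. *)
Definition quad_tuple (k : fieldType) (n : nat) (la : seq nat) : Type :=
  forall i : 'I_n, set ('rV[k]_(mult la i.+1.*2) -> k).

Definition nondeg_quad_tuples (k : fieldType) (n : nat) (la : seq nat) :
    set (quad_tuple k n la) :=
  [set Q | forall i, nondeg_isometry_classes (Q i)].

Arguments rational_orbits {k K} iota n la.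
Arguments nondeg_quad_tuples : clear implicits.

(* Main.v *)
Require Import Defs.
From HB Require Import structures.
From mathcomp Require Import all_boot all_order all_algebra.
From mathcomp Require Import boolp classical_sets functions.
From mathcomp Require Import zify ring.

Set Implicit Arguments.
Unset Strict Implicit.
Unset Printing Implicit Defensive.

Import Order.TTheory GRing.Theory Num.Theory.
Local Open Scope ring_scope.

(** Fix a Jordan matrix N of type lambda, acting on row vectors. An element X
    of the rational nilpotent orbit is conjugate to N over K, hence over k,
    because k is infinite ([similar_descent]). An invertible P with X P = P N
    transports the symplectic form to Om = P^-1 J P^-T, an antisymmetric
    invertible form for which N is skew; P is determined up to the centralizer
    Z(N), so the G-orbits are the congruence classes of such forms Om under
    Z(N) ([Ad_orbit_model]).

    Let u run through the generators of the Jordan blocks of size j. The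
    matrix B_j with entries Om(u, u' N^(j-1)) is the matrix, in the basis
    given by these generators, of the form (x, y) |-> Om(x, y N^(j-1)) on ker
    N^j modulo its radical ker N^(j-1) + (ker N^(j+1)) N. It is nondegenerate,
    and symmetric or antisymmetric according to the parity of j. For even j it
    is the quadratic form Q_j; for odd j it carries no information, since
    invertible antisymmetric matrices of the same size are congruent.

    - The classes of the B_j are invariants of Om under Z(N), which acts on
      the generators of size j, modulo the radical, through GL_(m_j)
      ([leading_formE], [leading_congruent]).
    - They determine Om up to Z(N). Congruences between the B_j and the B'_j
      lift to Z(N) ([frame_lift]), so assume B_j = B'_j for all j. Then h =
      Om' Om^-1 commutes with N, and h - 1 sends a vector of ker N lying in im
      N^i to one lying in im N^(i+1); hence h is unipotent
      ([skew_ratio_nilp]). As 2 is invertible, h has a square root s that is a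
      polynomial in h; it commutes with N and is self-adjoint for Om, so s Om
      s^T = s^2 Om = Om' ([leading_eq_isometry]).
    - All tuples occur: the B_j can be prescribed along the antidiagonals of
      the blocks ([leading_realization]), and the resulting form is congruent
      to J ([antisymmx_congruent_std]). *)

(** * Congruence of antisymmetric matrices *)

Section Congruence.
Variables (F : fieldType).
Implicit Types m : nat.

Definition congruent m (A B : 'M[F]_m) : Prop :=
  exists2 P, P \in unitmx & P *m A *m P^T = B.

Lemma congruent_trans m (A B C : 'M[F]_m) :
  congruent A B -> congruent B C -> congruent A C.
Proof.
move=> [P Pu <-] [Q Qu <-]; exists (Q *m P); first by rewrite unitmx_mul Qu.
by rewrite trmx_mul !mulmxA.
Qed.

Lemma congruent_sym m (A B : 'M[F]_m) : congruent A B -> congruent B A.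
Proof.
move=> [P Pu <-]; exists (invmx P); first by rewrite unitmx_inv.
by rewrite trmx_inv !mulmxA mulVmx // mul1mx mulmxK // unitmx_tr.
Qed.

Lemma congruent_unitmx m (A B : 'M[F]_m) :
  congruent A B -> (B \in unitmx) = (A \in unitmx).
Proof. by move=> [P Pu <-]; rewrite !unitmx_mul unitmx_tr Pu andbT. Qed.

Definition antisymmx m (A : 'M[F]_m) : Prop := A^T = - A.

Lemma trmx_antisym m p q (A : 'M[F]_m) (X : 'M_(p, m)) (Y : 'M_(q, m)) :
  antisymmx A -> (X *m A *m Y^T)^T = - (Y *m A *m X^T).
Proof. by move=> Aalt; rewrite !trmx_mul trmxK Aalt mulNmx mulmxN mulmxA. Qed.

(** The orthogonal sum of hyperbolic planes; in odd size, the last block 0 of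
    size 1 is a filler, as no antisymmetric matrix of odd size is invertible
    when 2 is. *)
Fixpoint std_symplectic m : 'M[F]_m :=
  if m is m'.+2 then
    block_mx (Jmx F 1) 0 0 (std_symplectic m') : 'M_(1 + 1 + m')
  else 0.

Lemma Jmx_unit n : Jmx F n \in unitmx.
Proof.
suff /mulmx1_unit[] : Jmx F n *m (- Jmx F n) = 1%:M by [].
rewrite /Jmx opp_block_mx mulmx_block !(mul0mx, mulmx0, oppr0, opprK).
by rewrite !(add0r, addr0) mulNmx mulmxN !mul1mx opprK -scalar_mx_block.
Qed.

Lemma Jmx_antisym n : antisymmx (Jmx F n).
Proof.
by rewrite /antisymmx tr_block_mx opp_block_mx !trmx0 linearN /= trmx1 oppr0
  opprK.
Qed.

Lemma std_symplecticP m : ~~ odd m ->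
  antisymmx (std_symplectic m) /\ std_symplectic m \in unitmx.
Proof.
elim/ltn_ind: m => -[|[|m]] IH //= mE.
  by split; [apply/matrixP => -[] | rewrite unitmxE det_mx00 unitr1].
have [|//|mA mU] := IH m; first by rewrite ltnS leqnSn.
  by rewrite negbK in mE.
split.
  have trE : (block_mx (Jmx F 1) 0 0 (std_symplectic m))^T =
      - block_mx (Jmx F 1) 0 0 (std_symplectic m).
    by rewrite tr_block_mx opp_block_mx mA Jmx_antisym !trmx0 !oppr0.
  exact: trE.
by rewrite unitmxE (det_ublock (Jmx F 1)) unitrM -!unitmxE Jmx_unit.
Qed.

Hypothesis two_neq0 : 2%:R != 0 :> F.

Lemma eq_opp0 (x : F) : x = - x -> x = 0.
Proof.
move/eqP; rewrite -subr_eq0 opprK -mulr2n -mulr_natl mulf_eq0.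
by rewrite (negPf two_neq0) => /eqP.
Qed.

Lemma antisymmx_self m (A : 'M[F]_m) (x : 'rV_m) :
  antisymmx A -> x *m A *m x^T = 0.
Proof.
move=> Aalt; apply/matrixP => i j; rewrite !ord1 [RHS]mxE.
have /matrixP/(_ 0 0) := trmx_antisym x x Aalt.
by rewrite mxE [RHS]mxE => /eq_opp0.
Qed.

(** Two vectors x, y with x A y^T = 1 span a hyperbolic plane, which splits
    off together with its orthogonal complement; the complement is again
    nondegenerate, and one concludes by induction on the size. *)
Lemma antisymmx_congruent_std m (A : 'M[F]_m) :
  antisymmx A -> A \in unitmx -> congruent A (std_symplectic m).
Proof.
elim/ltn_ind: m A => -[|[|m]] IH A Aalt Au.
- by exists 1%:M; [exact: unitmx1 | apply/matrixP => -[]].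
- have A0 : A = 0.
    apply/matrixP => i j; rewrite !ord1 [RHS]mxE; apply: eq_opp0.
    by rewrite -[in LHS](trmxK A) mxE Aalt mxE.
  by move: Au; rewrite A0 unitmxE det0 unitr0.
have [i [j Aij]] : exists i j, A i j != 0.
  apply: contrapT => nA; move: Au.
  rewrite (_ : A = 0) ?unitmxE ?det0 ?unitr0 //.
  apply/matrixP => i j; rewrite mxE; apply/eqP/negPn/negP => Aij.
  by apply: nA; exists i, j.
pose x : 'rV[F]_m.+2 := (A i j)^-1 *: delta_mx 0 i.
pose y : 'rV[F]_m.+2 := delta_mx 0 j.
have xy : x *m A *m y^T = 1%:M.
  apply/matrixP => a b; rewrite !ord1 /x -!scalemxAl trmx_delta -rowE -colE.
  by rewrite !mxE mulVf.
have yx : y *m A *m x^T = - 1%:M.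
  by apply: trmx_inj; rewrite trmx_antisym // xy linearN /= trmx1.
pose U : 'M[F]_(1 + 1, m.+2) := col_mx x y.
have UAU : U *m A *m U^T = Jmx F 1.
  by rewrite mul_col_mx tr_col_mx mul_col_row xy yx !antisymmx_self.
have rAU : \rank (A *m U^T) = 2.
  apply/anti_leq; rewrite rank_leq_col /=.
  by have := mxrankM_maxr U (A *m U^T); rewrite mulmxA UAU mxrank_unit
    ?Jmx_unit.
have [W WAU Wfree] :
    exists2 W : 'M[F]_(m, m.+2), W *m (A *m U^T) = 0 & row_free W.
  have rK : \rank (kermx (A *m U^T)) = m by rewrite mxrank_ker rAU subn2.
  exists (castmx (rK, erefl) (row_base (kermx (A *m U^T)))).
    apply/sub_kermxP; rewrite (eqmx_cast (row_base _) (rK, erefl)).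
    by rewrite eq_row_base.
  rewrite /row_free (eqmx_cast (row_base _) (rK, erefl)) eq_row_base.
  by rewrite rK.
have UAW : U *m A *m W^T = 0.
  by apply: trmx_inj; rewrite trmx_antisym // -mulmxA WAU trmx0 oppr0.
pose P : 'M[F]_(1 + 1 + m) := col_mx U W.
have PAP : P *m A *m P^T = block_mx (Jmx F 1) 0 0 (W *m A *m W^T).
  by rewrite mul_col_mx tr_col_mx mul_col_row UAU UAW -[W *m A *m U^T]mulmxA
    WAU.
have Pu : P \in unitmx.
  rewrite -row_free_unit; apply: inj_row_free => v.
  rewrite -[v]hsubmxK mul_row_col => vP.
  have l0 : lsubmx v = 0.
    have := congr1 (mulmx^~ (A *m U^T)) vP.
    rewrite /= mulmxDl mul0mx -[X in _ + X]mulmxA WAU mulmx0 addr0.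
    rewrite -mulmxA (mulmxA U) UAU => /(congr1 (mulmx^~ (invmx (Jmx F 1)))) /=.
    by rewrite mulmxK ?Jmx_unit // mul0mx.
  move: vP; rewrite l0 mul0mx add0r => /eqP.
  by rewrite mulmx_free_eq0 // => /eqP ->; rewrite row_mx0.
have AB : congruent A (block_mx (Jmx F 1) 0 0 (W *m A *m W^T) : 'M_(1 + 1 + m)).
  by exists P.
have Walt : antisymmx (W *m A *m W^T).
  exact: trmx_antisym.
have Wu : W *m A *m W^T \in unitmx.
  have := congruent_unitmx AB.
  by rewrite Au unitmxE (det_ublock (Jmx F 1)) unitrM -!unitmxE => /andP[].
have [//|Q Qu QW] := IH m _ _ Walt Wu.
apply: congruent_trans AB _; pose D : 'M[F]_(1 + 1 + m) := block_mx 1%:M 0 0 Q.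
have DAD : D *m block_mx (Jmx F 1) 0 0 (W *m A *m W^T) *m D^T =
    std_symplectic m.+2.
  rewrite tr_block_mx !mulmx_block !trmx0 trmx1
    !(mul0mx, mulmx0, mul1mx, mulmx1).
  by rewrite !(add0r, addr0) mul0mx QW.
exists D => //.
by rewrite unitmxE (det_ublock (1%:M : 'M_(1 + 1))) det1 mul1r -unitmxE.
Qed.

End Congruence.

(** * Descent of similarity to an infinite subfield *)

Section Descent.
Variables (k K : fieldType) (iota : {rmorphism k -> K}).
Hypothesis k_infinite : forall m, exists2 s : seq k, uniq s & size s = m.

(** The embedding of k supplies more points than p has roots. *)
Lemma poly_nonroot (p : {poly K}) : p != 0 -> exists b, p.[iota b] != 0.
Proof.
move=> p0; have [s s_uniq s_size] := k_infinite (size p).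
apply: contrapT => nroot.
have : (size (map iota s) < size p)%N.
  apply: max_poly_roots => //; last by rewrite (map_inj_uniq (fmorph_inj iota)).
  apply/allP => _ /mapP[b _ ->]; rewrite rootE; apply/negPn/negP => pb.
  by apply: nroot; exists b.
by rewrite size_map s_size ltnn.
Qed.

(** The coefficients can be moved from K into k one at a time: as a function
    of one coefficient, the determinant is a nonzero polynomial. *)
Lemma unitmx_specialize d r (A : 'M[k]_d) (M : 'I_r -> 'M[k]_d)
    (c : 'I_r -> K) :
  map_mx iota A + \sum_i c i *: map_mx iota (M i) \in unitmx ->
  exists b : 'I_r -> k, A + \sum_i b i *: M i \in unitmx.
Proof.
elim: r A M c => [|r IH] A M c.
  rewrite big_ord0 addr0 map_unitmx => Au; exists (fun=> 0).
  by rewrite big_ord0 addr0.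
rewrite big_ord_recl /=; set R := \sum_(i < r) _ => cu.
pose p : {poly K} := \det (map_mx polyC (map_mx iota A + R)
   + 'X *: map_mx polyC (map_mx iota (M ord0))).
have pE x : p.[x] = \det (map_mx iota A + (x *: map_mx iota (M ord0) + R)).
  rewrite -[p.[x]]/(horner_eval x p) -det_map_mx; congr (\det _).
  apply/matrixP => i j; rewrite !mxE /= /horner_eval.
  rewrite hornerD hornerM hornerX !hornerC.
  by rewrite -addrA; congr (_ + _); rewrite addrC.
have p0 : p != 0.
  apply: contraTneq cu => p0.
  by rewrite unitmxE -pE p0 horner0 unitr0.
have [b pb] := poly_nonroot p0.
have [|b' b'u] := IH (A + b *: M ord0) (M \o lift ord0) (c \o lift ord0).
  by rewrite map_mxD map_mxZ -addrA unitmxE unitfE -pE.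
exists (fun i => oapp b' b (unlift ord0 i)).
rewrite big_ord_recl unlift_none /=.
by under eq_bigr do rewrite liftK; rewrite addrA.
Qed.

(** The matrices P with X P = P N form the kernel of a linear map defined
    over k, so over K they are the K-combinations of finitely many matrices
    over k; some k-combination is invertible by [unitmx_specialize]. *)
Lemma similar_descent d (X N : 'M[k]_d) :
  (exists2 P, P \in unitmx & map_mx iota X *m P = P *m map_mx iota N) ->
  exists2 P, P \in unitmx & X *m P = P *m N.
Proof.
case=> P Pu XP.
pose T : 'M[k]_(d * d) := lin_mx (mulmx X) - lin_mx (mulmxr N).
have TE Q : mxvec Q *m T = mxvec (X *m Q - Q *m N).
  by rewrite mulmxBr !mul_vec_lin linearB.
have mapT : map_mx iota T =
    lin_mx (mulmx (map_mx iota X)) - lin_mx (mulmxr (map_mx iota N)).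
  by rewrite map_mxB; congr (_ - _); apply: map_lin_mx => A /=; rewrite map_mxM.
have /submxP[c Pc] : (mxvec P <= map_mx iota (kermx T))%MS.
  rewrite map_kermx; apply/sub_kermxP; rewrite mapT mulmxBr !mul_vec_lin /=.
  by rewrite XP subrr.
pose M i := vec_mx (row i (kermx T)) : 'M[k]_d.
have MP i : X *m M i = M i *m N.
  apply/eqP; rewrite -subr_eq0 -mxvec_eq0 -TE vec_mxK.
  by rewrite -row_mul mulmx_ker row0.
have [b bu] : exists b : 'I_(d * d) -> k, 0 + \sum_i b i *: M i \in unitmx.
  apply: (@unitmx_specialize _ _ _ _ (fun i => c 0 i)).
  rewrite map_mx0 add0r (_ : \sum_i _ = P) //.
  rewrite -[RHS]mxvecK Pc mulmx_sum_row linear_sum /=.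
  by apply: eq_bigr => i _; rewrite linearZ /= map_vec_mx map_row.
exists (\sum_i b i *: M i); first by rewrite -[X in X \in _]add0r.
rewrite mulmx_sumr mulmx_suml; apply: eq_bigr => i _.
by rewrite -scalemxAr -scalemxAl MP.
Qed.

End Descent.

(** * Square roots of unipotent matrices *)

Section SquareRoot.
Variable F : fieldType.
Hypothesis two_neq0 : 2%:R != 0 :> F.

(** Hensel lifting: if p^2 = 1 + X + X^r q and p(0) = 1, then p - (q(0)/2)
    X^r is a square root modulo X^(r+1). *)
Lemma poly_sqrt_1X r : (0 < r)%N ->
  exists p q : {poly F}, p ^+ 2 = 1 + 'X + 'X^r * q /\ p.[0] = 1.
Proof.
case: r => // r _; elim: r => [|r [p [q [pq p0]]]].
  by exists 1, (- 1); rewrite expr1n expr1 mulrN1 addrK hornerC.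
(* The correction that makes the error term vanish at 0. *)
pose c := q.[0] / 2%:R.
have : root (q - c%:P * p *+ 2 + c%:P ^+ 2 * 'X^(r.+1)) 0.
  rewrite rootE !hornerE p0 expr0n mulr0 addr0 mulr1 -mulr2n.
  by rewrite -mulr_natr divfK // subrr.
case/factor_theorem=> q'; rewrite subr0 => q'E.
have qE : q = q' * 'X + c%:P * p *+ 2 - c%:P ^+ 2 * 'X^(r.+1).
  by rewrite -q'E; ring.
exists (p - c%:P * 'X^(r.+1)), q'; split; last first.
  by rewrite !hornerE p0 expr0n mulr0 subr0.
rewrite sqrrB pq {1}qE ['X^(r.+2)]exprSr; ring.
Qed.

Lemma horner_mx_intertwine d (u w Z : 'M[F]_d.+1) (p : {poly F}) :
  u *m Z = Z *m w -> horner_mx u p *m Z = Z *m horner_mx w p.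
Proof.
move=> uZ; elim/poly_ind: p => [|p c IH];
  first by rewrite !rmorph0 mul0mx mulmx0.
rewrite !rmorphD !rmorphM /= !horner_mx_X !horner_mx_C mulmxDl mulmxDr.
by rewrite -!mulmxE -mulmxA uZ mulmxA IH -mulmxA scalar_mxC.
Qed.

Lemma trmx_horner_mx d (u : 'M[F]_d.+1) (p : {poly F}) :
  (horner_mx u p)^T = horner_mx u^T p.
Proof.
elim/poly_ind: p => [|p c IH]; first by rewrite !rmorph0 trmx0.
rewrite !rmorphD !rmorphM /= !horner_mx_X !horner_mx_C linearD /= -mulmxE.
rewrite trmx_mul tr_scalar_mx IH; congr (_ + _).
by have := @horner_mx_intertwine d u^T u^T u^T p erefl => ->.
Qed.

(** The square root is a polynomial in u, which is the reason why it
    inherits both the commutation relations of u and its self-adjointness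
    for a form Z. *)
Lemma unipotent_sqrt d (u : 'M[F]_d) M : u ^+ M = 0 ->
  exists2 s : 'M[F]_d, s *m s = 1%:M + u &
    forall Z, (u *m Z = Z *m u -> s *m Z = Z *m s) /\
              (u *m Z = Z *m u^T -> s *m Z = Z *m s^T).
Proof.
case: d u => [|d] u uM.
  exists 0; first by apply/matrixP => -[].
  by move=> Z; split=> _; apply/matrixP => -[].
have [p [q [pq _]]] := poly_sqrt_1X (ltn0Sn M).
exists (horner_mx u p).
  rewrite mulmxE -expr2 -rmorphXn /= pq !rmorphD rmorphM /= rmorph1 rmorphXn /=.
  by rewrite horner_mx_X exprS uM mulr0 mul0r addr0.
by move=> Z; split=> uZ; rewrite ?trmx_horner_mx; apply: horner_mx_intertwine.
Qed.
End SquareRoot.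

(** * Forms for which a Jordan matrix is skew *)

(** A basis adapted to N, grouped by block size: the rows of [E j a] are the
    images by N^a of the generators of the [m j] Jordan blocks of size j.
    The basis is orthonormal for the standard scalar product, so the
    coordinates of x along the rows of [E j a] are x (E j a)^T. All blocks
    have size at most L. *)
Record jordan_frame (F : fieldType) (D L : nat) (m : nat -> nat) (N : 'M[F]_D)
    (E : forall j, nat -> 'M[F]_(m j, D)) : Prop := {
  frame_ortho1 : forall j a, (a < j)%N -> E j a *m (E j a)^T = 1%:M;
  frame_ortho0 : forall j a l b, (j != l) || (a != b) ->
    E j a *m (E l b)^T = 0;
  frame_sum1 : \sum_(j < L.+1) \sum_(a < j) (E j a)^T *m E j a = 1%:M;
  frameN : forall j a, E j a *m N = E j a.+1;
  frame_out : forall j a, (j <= a)%N -> E j a = 0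
}.

Section Frame.
Variables (F : fieldType) (D L : nat) (m : nat -> nat) (N : 'M[F]_D).
Variable E : forall j, nat -> 'M[F]_(m j, D).
Hypothesis fE : jordan_frame L N E.

Lemma frame_expand p (x : 'M[F]_(p, D)) :
  x = \sum_(j < L.+1) \sum_(a < j) x *m (E j a)^T *m E j a.
Proof.
rewrite -{1}[x]mulmx1 -(frame_sum1 fE) mulmx_sumr; apply: eq_bigr => j _.
by rewrite mulmx_sumr; apply: eq_bigr => a _; rewrite mulmxA.
Qed.

Lemma frame_ext p (A B : 'M[F]_(D, p)) :
  (forall j a, (a < j <= L)%N -> E j a *m A = E j a *m B) -> A = B.
Proof.
move=> AB; rewrite -[A]mul1mx -[B]mul1mx -(frame_sum1 fE) !mulmx_suml.
apply: eq_bigr => j _; rewrite !mulmx_suml; apply: eq_bigr => a _.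
by rewrite -!mulmxA AB // ltn_ord -ltnS ltn_ord.
Qed.

Lemma frame_ext2 (A B : 'M[F]_D) :
  (forall j a l b, (a < j <= L)%N -> (b < l <= L)%N ->
     E j a *m A *m (E l b)^T = E j a *m B *m (E l b)^T) -> A = B.
Proof.
move=> AB; apply: frame_ext => j a ja; apply: trmx_inj.
apply: frame_ext => l b lb; apply: trmx_inj.
by rewrite !trmx_mul !trmxK AB.
Qed.

Lemma frame_sum_at p q (f : nat -> nat -> 'M[F]_(p, q)) j a0 :
  (a0 < j <= L)%N ->
  (forall l a, (a < l <= L)%N -> (l != j) || (a != a0) -> f l a = 0) ->
  \sum_(l < L.+1) \sum_(a < l) f l a = f j a0.
Proof.
move=> /andP[aj jL] f0; rewrite (bigD1 (inord j)) //= inordK // [X in _ + X]big1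
  => [|l lj].
  rewrite addr0 (bigD1 (Ordinal aj)) //= [X in _ + X]big1 => [|a aa].
    by rewrite addr0.
  by rewrite f0 ?ltn_ord // eqxx.
rewrite big1 // => a _; rewrite f0 //; first by rewrite ltn_ord -ltnS /=.
by apply/orP; left; apply: contra_neq lj => <-; rewrite inord_val.
Qed.

Definition frame_build p (f : forall j, nat -> 'M[F]_(m j, p)) : 'M[F]_(D, p) :=
  \sum_(j < L.+1) \sum_(a < j) (E j a)^T *m f j a.

Lemma frame_buildE p (f : forall j, nat -> 'M[F]_(m j, p)) j a :
  (a < j <= L)%N -> E j a *m frame_build f = f j a.
Proof.
move=> ajL; have /andP[aj jL] := ajL; rewrite mulmx_sumr.
under eq_bigr do rewrite mulmx_sumr.
rewrite (@frame_sum_at _ _ (fun l b => E j a *m ((E l b)^T *m f l b)) j a) //.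
  by rewrite mulmxA (frame_ortho1 fE) // mul1mx.
move=> l b _ lb; rewrite mulmxA (frame_ortho0 fE) ?mul0mx //.
by rewrite ![_ == l]eq_sym ![a == _]eq_sym.
Qed.

Lemma frameNX j a c : E j a *m N ^+ c = E j (a + c).
Proof.
elim: c a => [|c IH] a; first by rewrite expr0 mulmx1 addn0.
by rewrite exprS mulmxA (frameN fE) IH addnS.
Qed.

(** In the orthonormal basis of the frame, the transpose of N is the
    backward shift. *)
Lemma frame_trN j a : (a.+1 < j)%N -> N *m (E j a.+1)^T = (E j a)^T.
Proof.
move=> aj; apply: frame_ext => l b _; rewrite mulmxA (frameN fE).
have [lj|lj] := eqVneq l j; last by rewrite !(frame_ortho0 fE) ?lj.
rewrite lj; have [->|ba] := eqVneq b a.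
  by rewrite !(frame_ortho1 fE) // ltnW.
by rewrite !(frame_ortho0 fE) ?eqSS ?ba ?orbT.
Qed.

Lemma frame_trN0 j : N *m (E j 0)^T = 0.
Proof.
apply: frame_ext => l b _; rewrite mulmxA (frameN fE) mulmx0.
by rewrite (frame_ortho0 fE) // orbT.
Qed.

Lemma frame_trNX j a c : (a + c < j)%N -> N ^+ c *m (E j (a + c))^T = (E j a)^T.
Proof.
elim: c a => [|c IH] a ac; first by rewrite expr0 mul1mx addn0.
rewrite exprS -mulmxE -mulmxA addnS -addSn IH ?addSn -1?addnS //.
by rewrite frame_trN // (leq_ltn_trans _ ac) // addnS ltnS leq_addr.
Qed.

Lemma frame_trN_top j : (0 < j)%N -> N ^+ j.-1 *m (E j j.-1)^T = (E j 0)^T.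
Proof.
by move=> j0; rewrite -[in E j _](add0n j.-1) frame_trNX // ltn_predL.
Qed.

Lemma frame_trN_last j : N ^+ j *m (E j j.-1)^T = 0.
Proof.
case: j => [|j]; first by rewrite (frame_out fE) // trmx0 mulmx0.
rewrite exprS -mulmxE -mulmxA.
by rewrite -[j.+1.-1]add0n frame_trNX // frame_trN0.
Qed.

Lemma frame_nilp : N ^+ L = 0.
Proof.
apply: frame_ext => j a /andP[_ jL]; rewrite frameNX mulmx0.
by rewrite (frame_out fE) // (leq_trans jL) // leq_addl.
Qed.

Definition skew_wrt (Om : 'M[F]_D) : Prop := N *m Om = - (Om *m N^T).

(** The matrix of (x, y) |-> Om(x, y N^(j-1)) on the generators of the
    blocks of size j. These are the forms that classify Om. *)
Definition leading_form (Om : 'M[F]_D) j : 'M[F]_(m j) :=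
  E j 0 *m Om *m (E j j.-1)^T.

Section Form.
Variable Om : 'M[F]_D.
Hypothesis skewOm : skew_wrt Om.

Lemma skewX c : N ^+ c *m Om = (-1) ^+ c *: (Om *m (N ^+ c)^T).
Proof.
elim: c => [|c IH]; first by rewrite !expr0 mul1mx trmx1 mulmx1 scale1r.
rewrite exprSr -mulmxE -mulmxA skewOm mulmxN mulmxA IH -scalemxAl -mulmxA.
rewrite -trmx_mul mulmxE -exprS -exprSr.
by rewrite [(-1) ^+ c.+1]exprS mulN1r scaleNr.
Qed.

Lemma skew_shift p q (x : 'M[F]_(p, D)) (y : 'M[F]_(q, D)) c :
  x *m Om *m (y *m N ^+ c)^T = (-1) ^+ c *: (x *m N ^+ c *m Om *m y^T).
Proof.
rewrite -(mulmxA x (N ^+ c)) skewX -scalemxAr -scalemxAl scalerA -exprMn mulrNN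
  mulr1.
by rewrite expr1n scale1r trmx_mul !mulmxA.
Qed.

(** All powers of N can be moved to one side, where the exponent is at least
    the length of the chain. *)
Lemma frame_form0 j a l b : (j <= a + b)%N || (l <= a + b)%N ->
  E j a *m Om *m (E l b)^T = 0.
Proof.
case/orP => le.
  rewrite -[b]add0n -frameNX skew_shift frameNX (frame_out fE) //.
  by rewrite !mul0mx scaler0.
have out : E l (b + a) = 0 by rewrite (frame_out fE) // addnC.
have := skew_shift (E j 0) (E l b) a; rewrite !frameNX add0n => /eqP.
by rewrite out trmx0 mulmx0 eq_sym scaler_eq0 signr_eq0 => /eqP.
Qed.

(** A vector killed by N^j has components only on the last j vectors of each
    chain. *)
Lemma ker_frame0 p (x : 'M[F]_(p, D)) j l a :
  x *m N ^+ j = 0 -> (a + j < l)%N -> x *m (E l a)^T = 0.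
Proof. by move=> xN al; rewrite -(frame_trNX al) mulmxA xN mul0mx. Qed.

(** The last vector of a chain of length l pairs only with generators of
    chains of length at least l, and among those, y in ker N^j with j <= l
    involves only the ones of length j. *)
Lemma frame_last_form q (y : 'M[F]_(q, D)) j l :
  (0 < j <= L)%N -> (j <= l)%N -> y *m N ^+ j = 0 ->
  E l l.-1 *m Om *m y^T =
  if l == j then E l l.-1 *m Om *m (E j 0)^T *m (y *m (E j 0)^T)^T else 0.
Proof.
move=> /andP[j0 jL] jl yN.
have zero l' b : (b < l' <= L)%N -> (l != j) || ((l' != j) || (b != 0)%N) ->
    E l l.-1 *m Om *m (y *m (E l' b)^T *m E l' b)^T = 0.
  move=> bl' ne; rewrite trmx_mul mulmxA.
  have [ll'|ll'] := leqP l (l.-1 + b); first by rewrite frame_form0 ?ll'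
    ?mul0mx.
  have [l'l|l'l] := leqP l' (l.-1 + b).
    by rewrite frame_form0 ?l'l ?orbT ?mul0mx.
  by rewrite (ker_frame0 yN) ?trmx0 ?mulmx0 //; lia.
rewrite {1}(frame_expand y) linear_sum mulmx_sumr /=.
under eq_bigr do rewrite linear_sum mulmx_sumr /=.
have [lj|lj] := eqVneq l j; last first.
  rewrite big1 // => l' _; rewrite big1 // => b _.
  by rewrite zero ?lj // ltn_ord -ltnS ltn_ord.
subst l; rewrite (@frame_sum_at _ _ (fun l' b =>
   E j j.-1 *m Om *m (y *m (E l' b)^T *m E l' b)^T) j 0) ?j0 //.
  by rewrite [(_ *m E j 0)^T]trmx_mul mulmxA.
by move=> l' b bl' ne; rewrite zero // ne orbT.
Qed.

(** This makes [leading_form] intrinsic: on ker N^j the form Om(x, y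
    N^(j-1)) depends only on the components along the generators of the
    blocks of size j, all other basis vectors of ker N^j being in its
    radical. *)
Lemma leading_formE p q (x : 'M[F]_(p, D)) (y : 'M[F]_(q, D)) j :
  (0 < j <= L)%N -> x *m N ^+ j = 0 -> y *m N ^+ j = 0 ->
  x *m Om *m (y *m N ^+ j.-1)^T =
  x *m (E j 0)^T *m leading_form Om j *m (y *m (E j 0)^T)^T.
Proof.
move=> j0L xN yN; have /andP[j0 jL] := j0L.
rewrite {1}(frame_expand x) !mulmx_suml.
under eq_bigr do rewrite !mulmx_suml.
rewrite (@frame_sum_at _ _ (fun l a =>
  x *m (E l a)^T *m E l a *m Om *m (y *m N ^+ j.-1)^T) j 0) //.
  have := frame_last_form j0L (leqnn j) yN; rewrite eqxx => last_form.
  have lead : E j 0 *m Om *m (y *m N ^+ j.-1)^T =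
      leading_form Om j *m (y *m (E j 0)^T)^T.
    rewrite skew_shift frameNX add0n last_form scalemxAl; congr (_ *m _).
    by have := skew_shift (E j 0) (E j 0) j.-1; rewrite !frameNX add0n.
  transitivity (x *m (E j 0)^T *m (E j 0 *m Om *m (y *m N ^+ j.-1)^T)).
    by rewrite !mulmxA.
  by rewrite lead !mulmxA.
move=> l a al ne.
transitivity (x *m (E l a)^T *m (E l a *m Om *m (y *m N ^+ j.-1)^T)).
  by rewrite !mulmxA.
have [lj|lj] := ltnP (a + j) l; first by rewrite (ker_frame0 xN) ?mul0mx.
rewrite (_ : _ *m (y *m _)^T = 0) ?mulmx0 //.
rewrite skew_shift frameNX; apply/eqP; rewrite scaler_eq0; apply/orP; right.
have [la|la] := leqP l (a + j.-1); first by rewrite (frame_out fE) // !mul0mx.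
have -> : (a + j.-1 = l.-1)%N by lia.
rewrite (frame_last_form j0L _ yN); last by lia.
by rewrite ifN //; lia.
Qed.

End Form.

(** An inverse is obtained from [leading_formE] for the generators x = E j 0
    and the vectors y, also in ker N^j, such that y N^(j-1) is Om-dual to x
    up to sign. *)
Lemma leading_unitmx (Om : 'M[F]_D) j :
  skew_wrt Om -> Om \in unitmx -> (0 < j <= L)%N ->
  leading_form Om j \in unitmx.
Proof.
move=> skewOm Omu j0L.
have /andP[j0 jL] := j0L.
have inv_skew c : (invmx Om)^T *m N ^+ c =
    (-1) ^+ c *: ((N ^+ c)^T *m (invmx Om)^T).
  apply: trmx_inj; rewrite linearZ /= !trmx_mul !trmxK.
  have := congr1 (mulmx (invmx Om)) (skewX skewOm c).
  rewrite -scalemxAr mulKmx // => /(congr1 (mulmx^~ (invmx Om))) /=.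
  rewrite -scalemxAl -!mulmxA mulmxV // mulmx1 => ->.
  by rewrite scalerA -exprMn mulrNN mulr1 expr1n scale1r.
pose y := E j j.-1 *m (invmx Om)^T.
have yN : y *m N ^+ j = 0.
  rewrite -mulmxA inv_skew -scalemxAr mulmxA -[E j j.-1]trmxK -trmx_mul.
  by rewrite frame_trN_last trmx0 mul0mx scaler0.
have yN1 : y *m N ^+ j.-1 = (-1) ^+ j.-1 *: (E j 0 *m (invmx Om)^T).
  rewrite -mulmxA inv_skew -scalemxAr mulmxA -[E j j.-1]trmxK -trmx_mul.
  by rewrite frame_trN_top // trmxK.
have xN : E j 0 *m N ^+ j = 0 by rewrite frameNX (frame_out fE).
have := leading_formE skewOm j0L xN yN.
rewrite yN1 (frame_ortho1 fE) // mul1mx linearZ /= -scalemxAr trmx_mul trmxK.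
rewrite mulmxA mulmxK // (frame_ortho1 fE) // =>
  /(congr1 ( *:%R ((-1) ^+ j.-1))).
rewrite scalerA -exprMn mulrNN mulr1 expr1n scale1r scalemxAr => /esym.
by case/mulmx1_unit.
Qed.

(** Since C commutes with N, it maps the generators of the blocks of size j
    into ker N^j, where [leading_formE] applies; the congruence is the block
    of C on these generators. *)
Lemma leading_congruent (Om C : 'M[F]_D) j :
  skew_wrt Om -> C *m N = N *m C -> (0 < j <= L)%N ->
  leading_form (C *m Om *m C^T) j \in unitmx ->
  congruent (leading_form Om j) (leading_form (C *m Om *m C^T) j).
Proof.
move=> skewOm CN j0L lu.
have CNX c : C *m N ^+ c = N ^+ c *m C.
  elim: c => [|c IH]; first by rewrite !expr0 mulmx1 mul1mx.
  by rewrite !exprS -!mulmxE mulmxA CN -mulmxA IH mulmxA.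
pose x := E j 0 *m C.
have xN : x *m N ^+ j = 0.
  by rewrite -mulmxA CNX mulmxA frameNX (frame_out fE) // mul0mx.
have xN1 : x *m N ^+ j.-1 = E j j.-1 *m C.
  by rewrite -mulmxA CNX mulmxA frameNX add0n.
have leadE : leading_form (C *m Om *m C^T) j =
    x *m (E j 0)^T *m leading_form Om j *m (x *m (E j 0)^T)^T.
  by rewrite -leading_formE // xN1 /leading_form trmx_mul !mulmxA.
exists (x *m (E j 0)^T) => //.
by move: lu; rewrite leadE !unitmx_mul => /andP[/andP[]].
Qed.
End Frame.

(** * Classification of these forms under the centralizer *)

(** Double orthogonality: the transpose of the cokernel matrix of M^T has
    its rows in ker M. *)
Lemma submx_perp (F : fieldType) D p (w : 'M[F]_(p, D)) (M : 'M[F]_D) :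
  (forall y : 'M[F]_D, y *m M = 0 -> w *m y^T = 0) ->
  exists z, w = z *m M^T.
Proof.
move=> wM; apply/submxP; rewrite submxE -[cokermx _]trmxK wM //.
by apply: trmx_inj; rewrite trmx_mul trmxK mulmx_coker trmx0.
Qed.

Section Classification.
Variables (F : fieldType) (D L : nat) (m : nat -> nat) (N : 'M[F]_D).
Variable E : forall j, nat -> 'M[F]_(m j, D).
Hypothesis fE : jordan_frame L N E.

Local Notation skew := (skew_wrt N).
Local Notation leading_form := (leading_form E).

(** Act by [P j] simultaneously on the j layers of the blocks of size j. *)
Lemma frame_lift (P : forall j, 'M[F]_(m j)) : (forall j, P j \in unitmx) ->
  exists2 C, C \in unitmx & C *m N = N *m C /\
    forall j a, (a < j <= L)%N -> E j a *m C = P j *m E j a.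
Proof.
move=> Pu; pose B (P : forall j, 'M[F]_(m j)) := frame_build L E
  (fun j a => P j *m E j a).
have BE Q j a : (a < j <= L)%N -> E j a *m B Q = Q j *m E j a.
  by move=> ajL; rewrite (frame_buildE fE).
exists (B P).
  suff /mulmx1_unit[] : B P *m B (fun j => invmx (P j)) = 1%:M by [].
  apply: (frame_ext fE) => j a ajL; rewrite mulmxA BE // -mulmxA BE // mulmxA.
  by rewrite mulmxV // mul1mx mulmx1.
split=> [|j a /BE //]; apply: (frame_ext fE) => j a ajL.
rewrite !mulmxA BE // -mulmxA (frameN fE).
have [ja|aj] := leqP j a.+1; first by rewrite (frame_out fE) // mulmx0 mul0mx.
by rewrite BE // aj; case/andP: ajL.
Qed.

(** On the blocks of size j, take Om(u N^a, u' N^b) to be (-1)^a B_j(u, u')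
    if a + b = j - 1, and 0 otherwise. The sign makes N skew, and
    antisymmetry of Om is then the parity condition on [B j]. *)
Lemma leading_realization (B : forall j, 'M[F]_(m j)) :
  (forall j, (B j)^T = (-1) ^+ j *: B j) -> (forall j, B j \in unitmx) ->
  exists2 Om, [/\ skew Om, antisymmx Om & Om \in unitmx] &
    forall j, (0 < j <= L)%N -> leading_form Om j = B j.
Proof.
move=> Bsym Bu.
pose f j a := (-1) ^+ a *: (B j *m E j (j.-1 - a)).
(* The inverse of Om is built from [g]: on each block it is antidiagonal too. *)
pose g j a := (-1) ^+ (j.-1 - a) *: (invmx (B j) *m E j (j.-1 - a)).
pose Om := frame_build L E f.
have OmE j a : (a < j <= L)%N -> E j a *m Om = f j a.
  by move=> ajL; rewrite (frame_buildE fE).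
exists Om; last first.
  move=> j /andP[j0 jL]; rewrite /leading_form OmE ?j0 // /f expr0 scale1r
    subn0.
  by rewrite -mulmxA (frame_ortho1 fE) ?mulmx1 // ltn_predL.
split.
- apply: (frame_ext2 fE) => j a l b ajL blL.
  have [/andP[aj jL] /andP[bl lL]] := (ajL, blL).
  rewrite mulmxA (frameN fE) mulmxN mulNmx [E j a *m _]mulmxA (OmE j a) //.
  rewrite -[f j a *m _ *m _]mulmxA -trmx_mul (frameN fE) /f.
  rewrite -scalemxAl -(mulmxA (B j)).
  have [ja|ja] := leqP j a.+1.
    rewrite [E j a.+1](frame_out fE) // !mul0mx (frame_ortho0 fE); last first.
      by apply/orP; right; lia.
    by rewrite mulmx0 scaler0 oppr0.
  rewrite OmE ?ja // /f exprS mulN1r scaleNr mulNmx -scalemxAl -mulmxA.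
  congr (- (_ *: (_ *m _))).
  have [lj|lj] := eqVneq j l; last by rewrite !(frame_ortho0 fE) ?lj.
  subst l; have [ba|ba] := eqVneq (j.-1 - a.+1)%N b.
    have e : (j.-1 - a = (j.-1 - a.+1).+1)%N by lia.
    by rewrite e -ba !(frame_ortho1 fE) //; lia.
  by rewrite !(frame_ortho0 fE) //; apply/orP; right; lia.
- apply: (frame_ext2 fE) => j a l b ajL blL.
  rewrite mulmxN mulNmx (OmE j a) //.
  rewrite (_ : E j a *m Om^T *m _ = (f l b *m (E j a)^T)^T); last first.
    by rewrite -OmE // !trmx_mul trmxK mulmxA.
  have [/andP[aj jL] /andP[bl lL]] := (ajL, blL).
  rewrite /f -!scalemxAl -!mulmxA.
  have [lj|lj] := eqVneq j l; last first.
    by rewrite !(frame_ortho0 fE) ?lj // 1?eq_sym ?lj // !mulmx0 !scaler0 trmx0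
      oppr0.
  subst l; have [ba|ba] := eqVneq (j.-1 - a)%N b.
    rewrite -ba (_ : j.-1 - (j.-1 - a) = a)%N; last by lia.
    rewrite !(frame_ortho1 fE) //; last by lia.
    rewrite !mulmx1 linearZ /= Bsym scalerA -exprD.
    have -> : (j.-1 - a + j = (j.-1 - a).*2 + a.+1)%N by lia.
    by rewrite exprD -mul2n exprM sqrrN expr1n expr1n mul1r exprS mulN1r
      scaleNr.
  rewrite !(frame_ortho0 fE) ?mulmx0 ?scaler0 ?trmx0 ?oppr0 //.
    by apply/orP; right.
  by apply/orP; right; lia.
- suff /mulmx1_unit[] : Om *m frame_build L E g = 1%:M by [].
  apply: (frame_ext fE) => j a ajL; have /andP[aj jL] := ajL.
  rewrite mulmxA OmE // /f -scalemxAl -mulmxA (frame_buildE fE); last by lia.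
  rewrite /g (_ : j.-1 - (j.-1 - a) = a)%N; last by lia.
  rewrite -scalemxAr scalerA -exprMn mulrNN mulr1 expr1n scale1r.
  by rewrite mulmxA mulmxV // mul1mx mulmx1.
Qed.

Hypothesis two_neq0 : 2%:R != 0 :> F.

Section Unipotent.
Variables Om Om' : 'M[F]_D.
Hypotheses (skewOm : skew Om) (skewOm' : skew Om') (Omu : Om \in unitmx).
Hypothesis leading_eq :
  forall j, (0 < j <= L)%N -> leading_form Om j = leading_form Om' j.

Let u := Om' *m invmx Om - 1%:M.

Lemma skew_ratioE : u *m Om = Om' - Om.
Proof. by rewrite mulmxBl mulmxKV // mul1mx. Qed.

Lemma skew_ratio_comm : u *m N = N *m u.
Proof.
rewrite /u mulmxBl mulmxBr mul1mx mulmx1; congr (_ - _).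
have : Om *m (invmx Om *m N) = Om *m (- N^T *m invmx Om).
  rewrite mulKVmx // mulNmx mulmxN mulmxA -mulNmx -[- (Om *m _)]skewOm.
  by rewrite mulmxK.
move/(congr1 (mulmx (invmx Om))); rewrite !mulKmx // -mulmxA => ->.
by rewrite !mulNmx mulmxN !mulmxA skewOm' mulNmx.
Qed.

(** Since the leading forms of Om and Om' agree, x N^i u is Om-orthogonal to
    ker N^(i+1); as N is skew for Om, the orthogonal of this kernel is the
    image of N^(i+1). *)
Lemma skew_ratio_height p (x : 'M[F]_(p, D)) i :
  (i < L)%N -> x *m N ^+ i.+1 = 0 ->
  exists2 x' : 'M[F]_(p, D), x' *m N ^+ i.+2 = 0 &
    x *m N ^+ i *m u = x' *m N ^+ i.+1.
Proof.
move=> iL xN; have iL' : (0 < i.+1 <= L)%N by [].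
have [y yN|z zE] := @submx_perp F D p (x *m N ^+ i *m u *m Om) (N ^+ i.+1).
  rewrite -[_ *m u *m Om]mulmxA skew_ratioE mulmxBr mulmxBl.
  apply: (scalerI (a := (-1) ^+ i)); first by rewrite signr_eq0.
  rewrite scaler0 scalerBr -(skew_shift skewOm) -(skew_shift skewOm').
  have := leading_formE fE skewOm iL' xN yN.
  have := leading_formE fE skewOm' iL' xN yN.
  by rewrite leading_eq //= => -> ->; rewrite subrr.
pose x' := (-1) ^+ i.+1 *: (z *m invmx Om).
have x'E : x *m N ^+ i *m u = x' *m N ^+ i.+1.
  rewrite -[LHS](mulmxK Omu) zE.
  have := skewX skewOm i.+1 => /(congr1 (mulmx (invmx Om))).
  rewrite -scalemxAr mulKmx // => NE.
  have -> : (N ^+ i.+1)^T = (-1) ^+ i.+1 *: (invmx Om *m (N ^+ i.+1 *m Om)).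
    by rewrite NE scalerA -exprMn mulrNN mulr1 expr1n scale1r.
  by rewrite -scalemxAr -scalemxAl /x' -scalemxAl !mulmxA mulmxK.
exists x' => //.
rewrite exprSr -mulmxE mulmxA -x'E -mulmxA skew_ratio_comm mulmxA.
by rewrite -(mulmxA x) mulmxE -exprSr xN mul0mx.
Qed.

(** Iterating [skew_ratio_height], u^L kills ker N; since u commutes with N,
    its powers then kill ker N^c for every c. *)
Lemma skew_ratio_nilp : exists M, u ^+ M = 0.
Proof.
have uN e c : u ^+ e *m N ^+ c = N ^+ c *m u ^+ e.
  have uN : GRing.comm u N by exact: skew_ratio_comm.
  by have /commrX/commr_sym/(@commrX _ _ _ e)/commr_sym := uN; apply.
have ker i p (x : 'M_(p, D)) : (i <= L)%N -> x *m N = 0 ->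
    exists2 x' : 'M_(p, D), x' *m N ^+ i.+1 = 0 & x *m u ^+ i = x' *m N ^+ i.
  elim: i => [|i IH] iL xN; first by exists x; rewrite ?expr1 ?expr0.
  have [y yN xy] := IH (ltnW iL) xN.
  have [z zN yz] := skew_ratio_height iL yN; exists z => //.
  by rewrite exprSr -mulmxE mulmxA xy.
have kerL p (x : 'M_(p, D)) : x *m N = 0 -> x *m u ^+ L = 0.
  by move=> /(ker L _ _ (leqnn L))[y _ ->]; rewrite (frame_nilp fE) mulmx0.
have kerX c p (x : 'M_(p, D)) : x *m N ^+ c = 0 -> x *m u ^+ (L * c) = 0.
  elim: c x => [|c IH] x; first by rewrite expr0 mulmx1 => ->; rewrite mul0mx.
  rewrite exprSr -mulmxE mulmxA => /kerL; rewrite -mulmxA -uN mulmxA => /IH.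
  by rewrite -mulmxA mulmxE -exprD -mulnS.
(* Since N^L = 0, the rows of the identity matrix lie in ker N^L. *)
by exists (L * L)%N; rewrite -[LHS]mul1mx kerX // mul1mx (frame_nilp fE).
Qed.

(** With s^2 = h = Om' Om^-1 and s self-adjoint for Om: s Om s^T = s^2 Om =
    Om'. *)
Lemma leading_eq_isometry : antisymmx Om -> antisymmx Om' ->
  exists2 C, C *m N = N *m C & C *m Om *m C^T = Om'.
Proof.
move=> Oma Oma'; have [M uM] := skew_ratio_nilp.
have [s ss sP] := unipotent_sqrt two_neq0 uM.
have hE : (1%:M + u) *m Om = Om'.
  by rewrite mulmxDl skew_ratioE mul1mx addrC subrK.
exists s; first by apply: (sP N).1; apply: skew_ratio_comm.
have sOm : s *m Om = Om *m s^T.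
  apply: (sP Om).2; apply: trmx_inj; rewrite [RHS]trmx_mul trmxK Oma.
  by rewrite mulmxN skew_ratioE linearB /= Oma Oma' opprB opprK addrC.
by rewrite -[LHS]mulmxA -sOm mulmxA ss hE.
Qed.

End Unipotent.

(** Lifting the congruences of the leading forms to the centralizer reduces
    the problem to forms with equal leading forms. *)
Lemma leading_congruent_isometry Om Om' :
  skew Om -> skew Om' -> antisymmx Om -> antisymmx Om' ->
  Om \in unitmx -> Om' \in unitmx ->
  (forall j, (0 < j <= L)%N ->
     congruent (leading_form Om j) (leading_form Om' j)) ->
  exists2 C, C \in unitmx & C *m N = N *m C /\ C *m Om *m C^T = Om'.
Proof.
move=> skOm skOm' Oma Oma' Omu Omu' cong.
have /(_ _)/cid2 -cP : forall j, exists2 P, P \in unitmx &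
    (0 < j <= L)%N -> P *m leading_form Om j *m P^T = leading_form Om' j.
  move=> j; have [jL|jL] := boolP (0 < j <= L)%N.
    by have [P Pu PE] := cong j jL; exists P.
  by exists 1%:M; rewrite ?unitmx1.
have [C Cu [CN CE]] := @frame_lift (fun j => s2val (cP j))
  (fun j => s2valP (cP j)).
have skOm1 : skew (C *m Om *m C^T).
  rewrite /skew_wrt !mulmxA -CN -(mulmxA C N) skOm mulmxN mulNmx.
  by rewrite -!mulmxA -!trmx_mul CN.
have Oma1 : antisymmx (C *m Om *m C^T) by exact: trmx_antisym.
have [||C' C'N C'E] := leading_eq_isometry skOm1 skOm' _ _ Oma1 Oma'.
- by rewrite !unitmx_mul unitmx_tr Cu Omu.
- move=> j jL; have /andP[j0 jL'] := jL; rewrite -(s2valP' (cP j) jL)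
  /leading_form.
  have jE : E j 0 *m C = s2val (cP j) *m E j 0 by rewrite CE ?j0.
  have jE' : E j j.-1 *m C = s2val (cP j) *m E j j.-1.
    by rewrite CE ?jL' ?ltn_predL ?j0.
  rewrite !mulmxA jE -[_ *m C^T *m _]mulmxA -trmx_mul jE' trmx_mul.
  by rewrite !mulmxA.
exists (C' *m C).
  by move: Omu'; rewrite -C'E !unitmx_mul => /andP[/andP[->]].
split; first by rewrite -mulmxA CN !mulmxA C'N.
by rewrite -C'E trmx_mul !mulmxA.
Qed.

End Classification.

(** * Quadratic forms and symmetric matrices *)

Section QuadraticForms.
Variables (F : fieldType) (m : nat).
Hypothesis two_neq0 : 2%:R != 0 :> F.
Implicit Types S : 'M[F]_m.

Definition qform S : 'rV[F]_m -> F := fun x => (x *m S *m x^T) 0 0.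

Lemma polar_qform S x y :
  S^T = S -> polar (qform S) x y = 2%:R * (x *m S *m y^T) 0 0.
Proof.
move=> Ssym; have yx : (y *m S *m x^T) 0 0 = (x *m S *m y^T) 0 0.
  have -> : y *m S *m x^T = (x *m S *m y^T)^T.
    by rewrite !trmx_mul trmxK Ssym mulmxA.
  by rewrite mxE.
rewrite /polar /qform linearD /= !mulmxDl !mulmxDr.
have addE (A B : 'M[F]_1) : (A + B) 0 0 = A 0 0 + B 0 0 by rewrite mxE.
by rewrite !addE yx; ring.
Qed.

Lemma qform_quadratic S : S^T = S -> quadratic_form (qform S).
Proof.
move=> Ssym; split=> [a x|y].
  by rewrite /qform linearZ /= -!scalemxAl -scalemxAr !mxE mulrA.
move=> a x z; rewrite /= !polar_qform // !mulmxDl -!scalemxAl.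
have addE (A B : 'M[F]_1) : (a *: A + B) 0 0 = a * A 0 0 + B 0 0.
  by rewrite !mxE.
by rewrite addE mulrDr mulrCA.
Qed.

(** The matrix is half the Gram matrix of the polar form. *)
Lemma quadratic_form_qform q : quadratic_form q ->
  exists2 S, S^T = S & q = qform S.
Proof.
move=> [qZ qlin].
have polarC x y : polar q x y = polar q y x.
  by rewrite /polar [y + x]addrC -!addrA [- q y + _]addrC.
have expand x y : polar q x y = \sum_i x 0 i * polar q (delta_mx 0 i) y.
  pose f : {scalar 'rV[F]_m} := HB.pack (polar q ^~ y)
    (GRing.isLinear.Build _ _ _ _ (polar q ^~ y) (qlin y)).
  rewrite -[LHS]/(f x) {1}(row_sum_delta x) linear_sum.
  by apply: eq_bigr => i _; rewrite linearZ.
pose S : 'M[F]_m := \matrix_(i, j) (polar q (delta_mx 0 i) (delta_mx 0 j) /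
  2%:R).
exists S; first by apply/matrixP => i j; rewrite !mxE polarC.
apply/funext => x.
have -> : q x = polar q x x / 2%:R.
  rewrite /polar -[x + x]mulr2n -scaler_nat qZ.
  by apply: (canRL (mulfK two_neq0)); ring.
rewrite expand /qform -mulmxA mxE mulr_suml; apply: eq_bigr => i _.
rewrite -mulrA; congr (_ * _); rewrite polarC expand mxE mulr_suml.
by apply: eq_bigr => j _; rewrite !mxE polarC [RHS]mulrC mulrA.
Qed.

Lemma qform_inj S S' : S^T = S -> S'^T = S' -> qform S =1 qform S' -> S = S'.
Proof.
move=> sS sS' SS'; apply/matrixP => i j.
have : polar (qform S) (delta_mx 0 i) (delta_mx 0 j) =
       polar (qform S') (delta_mx 0 i) (delta_mx 0 j) by rewrite /polar !SS'.
rewrite !polar_qform // => /(mulfI two_neq0).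
by rewrite trmx_delta -!rowE -!colE !mxE.
Qed.

Lemma nondeg_qform S : S^T = S -> nondeg_form (qform S) <-> S \in unitmx.
Proof.
move=> Ssym; split=> [nd|Su x xS].
  rewrite -row_free_unit; apply: inj_row_free => x xS; apply: nd => y.
  by rewrite polar_qform // xS mul0mx mxE mulr0.
apply: (can_inj (mulmxK Su)); rewrite mul0mx; apply/rowP => j; rewrite [RHS]mxE.
have := xS (delta_mx 0 j); rewrite polar_qform // => /eqP.
rewrite mulf_eq0 (negPf two_neq0) => /eqP.
by rewrite trmx_delta -colE mxE.
Qed.

Lemma isometric_qform S S' : S^T = S -> S'^T = S' ->
  isometric (qform S) (qform S') <-> congruent S' S.
Proof.
move=> sS sS'; split=> [[P Pu PE]|[P Pu <-]]; last first.
  by exists P => // x; rewrite /qform trmx_mul !mulmxA.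
exists P => //; apply: qform_inj => //.
  by rewrite !trmx_mul trmxK sS' mulmxA.
by move=> x; rewrite -PE /qform trmx_mul !mulmxA.
Qed.

Lemma isometry_class_qform S S' : S^T = S -> S'^T = S' ->
  isometry_class (qform S) = isometry_class (qform S') <-> congruent S S'.
Proof.
move=> sS sS'; split=> [SS'|SS'].
  have : isometry_class (qform S') (qform S').
    split; first exact: qform_quadratic.
    by exists 1%:M => [|x]; rewrite ?unitmx1 ?mulmx1.
  rewrite -SS' => -[_ iso]; apply: congruent_sym.
  exact: (isometric_qform sS sS').1 iso.
apply/seteqP; split=> q [qq iso]; have [T sT qE] := quadratic_form_qform qq;
  rewrite qE in iso *; (split; first exact: qform_quadratic).
  have TS := (isometric_qform sS sT).1 iso.
  by apply: (isometric_qform sS' sT).2; apply: congruent_trans TS SS'.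
have TS := (isometric_qform sS' sT).1 iso.
apply: (isometric_qform sS sT).2; apply: congruent_trans TS _.
exact: congruent_sym.
Qed.
End QuadraticForms.

(** * Generators of the Jordan blocks *)

Section JordanFrame.
Variables (F : fieldType) (la : seq nat) (L : nat).
Hypothesis la_le : {in la, forall j, (j <= L)%N}.

Let D := (\sum_(i < size la) nth 0%N la i)%N.

Let blk (r : 'I_D) : nat := tagnat.sig1 r.
Let pos (r : 'I_D) : nat := tagnat.sig2 r.

(** An index r of the block diagonal matrix is described by its block [blk
    r] and its position [pos r] in the block; N shifts the position by one. *)
Lemma nilp_jordan_mxE (r s : 'I_D) :
  nilp_jordan_mx F la r s = ((blk r == blk s) && (pos s == (pos r).+1))%:R.
Proof.
rewrite /nilp_jordan_mx mxE /blk /pos.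
move: (tagnat.sig2 r) (tagnat.sig2 s).
move: (tagnat.sig1 r) (tagnat.sig1 s) => i i' x y.
have [e|ne] := eqVneq i i'; last by rewrite mxE -val_eqE in ne *;
  rewrite (negPf ne).
by case: i' / e y => y; rewrite conform_mx_id mxE eqxx.
Qed.

Lemma blk_pos_inj r s : blk r = blk s -> pos r = pos s -> r = s.
Proof.
move=> rs1 rs2; apply: val_inj; rewrite /= [LHS]tagnat.rect [RHS]tagnat.rect.
by rewrite -/(blk r) -/(pos r) rs1 rs2.
Qed.

Lemma blk_lt r : (blk r < size la)%N.
Proof. exact: ltn_ord. Qed.

Lemma pos_lt r : (pos r < nth 0%N la (blk r))%N.
Proof. exact: ltn_ord. Qed.

Lemma blk_pos_ex i a : (i < size la)%N -> (a < nth 0%N la i)%N ->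
  exists2 r, blk r = i & pos r = a.
Proof.
move=> ilt alt; pose io := Ordinal ilt.
pose ao := @Ordinal (nth 0%N la io) a alt.
exists (@tagnat.Rank _ (fun i : 'I_(size la) => nth 0%N la i) io ao);
  first by rewrite /blk tagnat.Rank1K.
by rewrite /pos tagnat.Rank2K.
Qed.

Definition blocks_of j : seq nat :=
  [seq i <- iota 0 (size la) | nth 0%N la i == j].

Lemma size_blocks_of j : size (blocks_of j) = mult la j.
Proof.
rewrite size_filter /mult -[in RHS](mkseq_nth 0%N la) /mkseq count_map.
by apply: eq_count => i; rewrite /= eq_sym.
Qed.

Lemma mem_blocks_of j i :
  (i \in blocks_of j) = (i < size la)%N && (nth 0%N la i == j).
Proof. by rewrite mem_filter mem_iota andbC. Qed.

Definition block_ix j (u : 'I_(mult la j)) : nat := nth 0%N (blocks_of j) u.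

Lemma block_ixP j (u : 'I_(mult la j)) :
  (block_ix u < size la)%N /\ nth 0%N la (block_ix u) = j.
Proof.
have : block_ix u \in blocks_of j by rewrite mem_nth // size_blocks_of.
by rewrite mem_blocks_of => /andP[? /eqP].
Qed.

Lemma block_ix_inj j : injective (@block_ix j).
Proof.
move=> u u' /eqP; rewrite nth_uniq ?size_blocks_of ?filter_uniq ?iota_uniq //.
by move/eqP/val_inj.
Qed.

Lemma block_ix_ex r :
  exists u : 'I_(mult la (nth 0%N la (blk r))), block_ix u = blk r.
Proof.
set j := nth 0%N la (blk r).
have rb : blk r \in blocks_of j by rewrite mem_blocks_of blk_lt eqxx.
have ult : (index (blk r) (blocks_of j) < mult la j)%N.
  by rewrite -size_blocks_of index_mem.
by exists (Ordinal ult); rewrite /block_ix nth_index.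
Qed.

(** The row u is the basis vector at position a of the u-th block of size j. *)
Definition std_frame j a : 'M[F]_(mult la j, D) :=
  \matrix_(u, r) ((blk r == block_ix u) && (pos r == a))%:R.

Lemma std_frameE j a u r :
  std_frame j a u r = ((blk r == block_ix u) && (pos r == a))%:R.
Proof. by rewrite mxE. Qed.

Lemma std_frame_out j a : (j <= a)%N -> std_frame j a = 0.
Proof.
move=> ja; apply/matrixP => u r; rewrite std_frameE mxE.
have [/= rb|//] := eqVneq; have [ra|//] := eqVneq.
have [_ uj] := block_ixP u.
by have := pos_lt r; rewrite rb uj ra ltnNge ja.
Qed.

Lemma std_frame_delta j a (u : 'I_(mult la j)) : (a < j)%N ->
  exists2 r0, blk r0 = block_ix u /\ pos r0 = a &
    forall r, std_frame j a u r = (r == r0)%:R.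
Proof.
move=> aj; have [ult uj] := block_ixP u.
have [|r0 r0b r0a] := @blk_pos_ex _ a ult; first by rewrite uj.
exists r0 => // r; rewrite std_frameE; congr (_%:R).
have [->|ne] := eqVneq r r0; first by rewrite r0b r0a !eqxx.
congr (nat_of_bool _); apply: contra_neqF ne => /andP[/eqP rb /eqP ra].
by apply: blk_pos_inj; rewrite ?r0b ?r0a.
Qed.

Lemma std_frameP : jordan_frame L (nilp_jordan_mx F la) std_frame.
Proof.
split.
- move=> j a aj; apply/matrixP => u u'; rewrite !mxE.
  have [r [rb ra] rE] := std_frame_delta u aj.
  rewrite (bigD1 r) //= [X in _ + X]big1 => [|s sr];
    last by rewrite rE (negPf sr) mul0r.
  rewrite rE eqxx mul1r addr0 !mxE ?std_frameE rb ra eqxx andbT; congr (_%:R).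
  by rewrite (inj_eq (@block_ix_inj j)).
- move=> j a l b ne; apply/matrixP => u u'; rewrite !mxE; apply: big1 => r _.
  rewrite !mxE ?std_frameE -natrM mulnb; case: eqP => //= rb;
    case: eqP => //= ra.
  case: eqP => //= rb'; case: eqP => //= ra'; move: ne.
  have [_ <-] := block_ixP u; have [_ <-] := block_ixP u'.
  by rewrite -rb rb' -ra ra' !eqxx.
- apply/matrixP => r s; rewrite summxE [RHS]mxE.
  under eq_bigr do rewrite summxE.
  have [<-|ne] := eqVneq r s; last first.
    apply: big1 => j _; apply: big1 => a _; rewrite mxE; apply: big1 => u _.
    rewrite !mxE ?std_frameE -natrM mulnb.
    case: eqP => //= rb; case: eqP => //= ra; case: eqP => //= sb;
      case: eqP => //= sa.
    by move: ne; rewrite (@blk_pos_inj r s) ?eqxx // ?rb ?ra.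
  pose j := nth 0%N la (blk r).
  have jL : (j < L.+1)%N by rewrite ltnS la_le // mem_nth // blk_lt.
  have [u ub] := block_ix_ex r.
  rewrite (bigD1 (Ordinal jL)) //= [X in _ + X]big1 => [|l lj]; last first.
    apply: big1 => a _; rewrite mxE; apply: big1 => v _.
    rewrite !mxE ?std_frameE; case: eqP => //= [rb|_]; last by rewrite mul0r.
    by case/eqP: lj; apply: val_inj => /=; have [_ <-] := block_ixP v;
      rewrite -rb.
  rewrite addr0 (bigD1 (Ordinal (pos_lt r))) //= [X in _ + X]big1 => [|a ar];
    last first.
    rewrite mxE; apply: big1 => v _; rewrite !mxE ?std_frameE
      [pos r == a]eq_sym.
    by rewrite -val_eqE /= in ar; rewrite (negPf ar) andbF mul0r.
  rewrite addr0 mxE (bigD1 u) //= [X in _ + X]big1 => [|v vu]; last first.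
    rewrite !mxE ?std_frameE -ub [block_ix u == _]eq_sym
      (inj_eq (@block_ix_inj _)).
    by rewrite (negPf vu) mul0r.
  by rewrite !mxE ?std_frameE ub !eqxx mulr1 addr0.
- move=> j a; have [ja|aj] := leqP j a.
    by rewrite !std_frame_out ?mul0mx // leqW.
  apply/matrixP => u s; rewrite !mxE.
  have [r [rb ra] rE] := std_frame_delta u aj.
  rewrite (bigD1 r) //= [X in _ + X]big1 => [|t tr];
    last by rewrite rE (negPf tr) mul0r.
  by rewrite rE eqxx mul1r addr0 nilp_jordan_mxE rb ra eq_sym.
- exact: std_frame_out.
Qed.
End JordanFrame.

(** * Symplectic orbits and tuples of quadratic forms *)

(** The powers of a uniformizer have distinct valuations. *)
Lemma nonarch_infinite (k : fieldType) (v : k -> int) :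
  nonarch_local_field v -> forall m, exists2 s : seq k, uniq s & size s = m.
Proof.
move=> hk m; have [x x0 vx] := val_normalized hk.
have v1 : v 1 = 0.
  have := Defs.valM hk (oner_neq0 k) (oner_neq0 k).
  by rewrite mulr1 => /eqP; rewrite -subr_eq0 opprD addNKr oppr_eq0 => /eqP.
have vX i : v (x ^+ i) = i%:Z.
  elim: i => [|i IH]; first by rewrite expr0 v1.
  by rewrite exprS (Defs.valM hk) ?expf_neq0 // vx IH -intS.
exists (mkseq (fun i => x ^+ i) m); last by rewrite size_mkseq.
rewrite map_inj_uniq ?iota_uniq // => i j /(congr1 v).
by rewrite !vX => -[].
Qed.

Lemma two_neq0_of_pchar (k : fieldType) p N : odd p ->
  [pchar k] =i pred0 \/ (p \in [pchar k] /\ N) -> 2%:R != 0 :> k.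
Proof.
move=> p_odd ch; apply/negP => /eqP two0.
have k2 : 2%N \in [pchar k] by rewrite inE /= two0 eqxx.
case: ch => [ch0|[kp _]]; first by have := ch0 2%N; rewrite k2.
by move: p_odd; rewrite (eqP (etrans (esym (pcharf_eq k2 _)) kp)).
Qed.

(** The Jordan matrix has size [sumn la] only up to a provable equality;
    this lemma eliminates the cast once and for all, by providing a square
    model of size d. *)
Lemma jordan_model (k K : fieldType) (iota : {rmorphism k -> K})
    (la : seq nat) d :
  sumn la = d ->
  exists (N : 'M[k]_d) (E : forall j, nat -> 'M[k]_(mult la j, d)),
    jordan_frame d N E /\
    forall Y : 'M[K]_d, nilp_jordan_type Y la <->
      exists2 P, P \in unitmx & Y *m P = P *m map_mx iota N.
Proof.
move=> lad.
have la_le : {in la, forall j, (j <= d)%N}.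
  by move=> j /perm_to_rem/perm_sumn; rewrite lad => -> /=; rewrite leq_addr.
have e : (\sum_(i < size la) nth 0%N la i = d)%N.
  by rewrite -lad sumnE (big_nth 0%N) big_mkord.
move: la_le {lad}; case: d / e => la_le.
exists (nilp_jordan_mx k la), (std_frame k la); split; first exact: std_frameP.
have mapN : map_mx iota (nilp_jordan_mx k la) = nilp_jordan_mx K la.
  by apply/matrixP => r s; rewrite mxE !nilp_jordan_mxE rmorph_nat.
move=> Y; rewrite mapN; split=> [[P [Pf PF YP]]|[P Pu YP]]; exists P => //.
  by rewrite -row_free_unit.
by split=> //; rewrite ?row_free_unit ?row_full_unit.
Qed.

Section SymplecticFacts.
Variables (F : fieldType) (n : nat).
Local Notation J := (Jmx F n).

Lemma Jmx_sqr : J *m J = - 1%:M.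
Proof.
rewrite /Jmx mulmx_block !(mul0mx, mulmx0, mul1mx, mulmx1, add0r, addr0).
by rewrite (scalar_mx_block n n) opp_block_mx !oppr0.
Qed.

(** Conditions in terms of the rows, obtained from the given ones by
    inverting J; they suit the action on row vectors used for frames. *)
Lemma sp_row (X : 'M[F]_(n + n)) : sp X <-> X *m J = - (J *m X^T).
Proof.
rewrite /sp /=; split=> XJ.
  have := congr1 (fun Z => J *m Z *m J) XJ;
    rewrite mulmxDr mulmxDl mulmx0 mul0mx.
  rewrite -!mulmxA Jmx_sqr !mulmxA Jmx_sqr !mulmxN mulmx1 !mulNmx mul1mx.
  by move/eqP; rewrite addr_eq0 opprK => /eqP.
have := congr1 (fun Z => J *m Z *m J) XJ.
rewrite mulmxN mulNmx -!mulmxA Jmx_sqr !mulmxN mulmx1 !mulmxA Jmx_sqr.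
rewrite !mulNmx mul1mx opprK => XJ'.
by rewrite /= -XJ' addNr.
Qed.

Lemma Sp_row (g : 'M[F]_(n + n)) :
  Sp g <-> g \in unitmx /\ g *m J *m g^T = J.
Proof.
have H (h : 'M[F]_(n + n)) :
    h \in unitmx -> h *m J *m h^T = J -> h^T *m J *m h = J.
  move=> hu hJ.
  have : h *m J *m h^T *m (J *m h) = J *m J *m h by rewrite hJ mulmxA.
  rewrite Jmx_sqr -!mulmxA => /(congr1 (mulmx (invmx h))).
  rewrite mulKmx // mulNmx mul1mx mulmxN mulVmx // => /(congr1 (mulmx J)).
  by rewrite mulmxN mulmx1 !mulmxA Jmx_sqr !mulNmx mul1mx -!mulmxA => /oppr_inj.
split=> -[gu gJ]; split=> //; last exact: H.
by have := H g^T; rewrite unitmx_tr trmxK; apply.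
Qed.

Lemma Sp_mul (g h : 'M[F]_(n + n)) : Sp g -> Sp h -> Sp (g *m h).
Proof.
move=> [gu gJ] [hu hJ]; split; first by rewrite unitmx_mul gu.
by rewrite trmx_mul -!mulmxA (mulmxA J) (mulmxA g^T) (mulmxA g^T) gJ mulmxA.
Qed.

Lemma Sp_inv (g : 'M[F]_(n + n)) : Sp g -> Sp (invmx g).
Proof.
move=> [gu gJ]; split; first by rewrite unitmx_inv.
by rewrite -{1}gJ trmx_inv !mulmxA mulVmx ?unitmx_tr // mul1mx mulmxK.
Qed.

Lemma Ad_orbit_refl (X : 'M[F]_(n + n)) : Ad_orbit X X.
Proof.
by exists 1%:M; [split; rewrite ?unitmx1 // trmx1 mul1mx mulmx1
               | rewrite invmx1 mul1mx mulmx1].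
Qed.

Lemma Ad_orbit_sub (X Y : 'M[F]_(n + n)) :
  Ad_orbit X Y -> (Ad_orbit Y `<=` Ad_orbit X)%classic.
Proof.
move=> [g Sg ->] _ [h Sh ->]; exists (h *m g); first exact: Sp_mul.
case: Sg Sh => [gu _] [hu _].
rewrite (_ : invmx (h *m g) = invmx g *m invmx h) ?mulmxA //.
have hgu : h *m g \in unitmx by rewrite unitmx_mul hu.
by apply: (can_inj (mulmxK hgu)); rewrite mulVmx // mulmxA mulmxKV // mulVmx.
Qed.

Lemma Ad_orbit_eq (X Y : 'M[F]_(n + n)) :
  Ad_orbit X Y -> Ad_orbit X = Ad_orbit Y.
Proof.
move=> XY; apply/seteqP; split; last exact: Ad_orbit_sub.
apply: Ad_orbit_sub; case: XY => g Sg ->; exists (invmx g); first exact: Sp_inv.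
by case: Sg => gu _; rewrite invmxK -!mulmxA mulVmx // mulmx1 mulKmx.
Qed.
End SymplecticFacts.

Lemma leading_trmx (F : fieldType) D L m (N : 'M[F]_D)
    (E : forall j, nat -> 'M[F]_(m j, D)) (Om : 'M[F]_D) j :
  jordan_frame L N E -> skew_wrt N Om -> antisymmx Om -> (0 < j)%N ->
  (leading_form E Om j)^T = (-1) ^+ j *: leading_form E Om j.
Proof.
move=> fE sk Oma j0; rewrite /leading_form trmx_antisym //.
have := skew_shift sk (E j 0) (E j 0) j.-1.
rewrite !(frameNX fE) add0n => ->.
have -> : (-1) ^+ j.-1 = - (-1) ^+ j :> F.
  by rewrite -{2}(prednK j0) exprS mulN1r opprK.
by rewrite scaleNr scalerN scalerA -exprMn mulrNN mulr1 expr1n scale1r.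
Qed.

Section Orbits.
Variables (k : fieldType) (n : nat) (la : seq nat).
Hypothesis two_neq0 : 2%:R != 0 :> k.
Variables (N : 'M[k]_(n + n)) (E : forall j, nat -> 'M[k]_(mult la j, n + n)).
Hypothesis fE : jordan_frame (n + n) N E.
Hypothesis hodd : forall j : nat, odd j -> ~~ odd (mult la j).

Local Notation J := (Jmx k n).

(** The symplectic form read in the basis of rows of P^-1, a Jordan basis
    for X when X P = P N. *)
Definition model_form (P : 'M[k]_(n + n)) := invmx P *m J *m (invmx P)^T.

Lemma model_formP X P : sp X -> P \in unitmx -> X *m P = P *m N ->
  [/\ skew_wrt N (model_form P), antisymmx (model_form P)
    & model_form P \in unitmx].
Proof.
move=> /sp_row XJ Pu XP.
have PN : N *m invmx P = invmx P *m X.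
  by apply: (can_inj (mulmxK Pu)); rewrite mulmxKV // -mulmxA XP mulKmx.
split.
- rewrite /skew_wrt /model_form !mulmxA PN -(mulmxA _ X J) XJ mulmxN mulNmx.
  by rewrite -!mulmxA -!trmx_mul PN.
- exact/trmx_antisym/Jmx_antisym.
- by rewrite !unitmx_mul unitmx_tr unitmx_inv Pu Jmx_unit.
Qed.

(** An element g of G that conjugates X to X' corresponds to C = P'^-1 g P. *)
Lemma Ad_orbit_model X P X' P' :
  P \in unitmx -> X *m P = P *m N -> P' \in unitmx -> X' *m P' = P' *m N ->
  Ad_orbit X X' <-> exists2 C, C \in unitmx &
    C *m N = N *m C /\ C *m model_form P *m C^T = model_form P'.
Proof.
move=> Pu XP P'u XP'; split=> [[g /Sp_row[gu gJ] X'E]|[C Cu [CN CJ]]].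
  have X'g : X' *m g = g *m X by rewrite X'E mulmxKV.
  exists (invmx P' *m g *m P); first by rewrite !unitmx_mul unitmx_inv P'u gu.
  split.
    rewrite -[LHS]mulmxA -XP mulmxA -[invmx P' *m g *m X]mulmxA -X'g.
    apply: (can_inj (mulKmx P'u)).
    by rewrite !mulmxA mulmxV // mul1mx -XP' mulmxK.
  rewrite /model_form !trmx_mul !trmx_inv !mulmxA mulmxK //.
  rewrite (mulmxKV (_ : P^T \in unitmx)) ?unitmx_tr //.
  by rewrite -(mulmxA (invmx P') g) -(mulmxA (invmx P') (g *m J)) gJ.
have PCu : C *m invmx P \in unitmx by rewrite unitmx_mul unitmx_inv Cu.
pose g := P' *m (C *m invmx P).
have gu : g \in unitmx by rewrite unitmx_mul P'u.
exists g.
  apply/Sp_row; split=> //.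
  transitivity (P' *m model_form P' *m P'^T).
    by rewrite -CJ /g /model_form !trmx_mul !mulmxA.
  rewrite /model_form !mulmxA mulmxV // mul1mx trmx_inv mulmxKV //.
  by rewrite unitmx_tr.
apply: (can_inj (mulmxK gu)); rewrite mulmxKV // /g.
rewrite mulmxA XP' -!mulmxA; congr (_ *m _); rewrite mulmxA -CN -mulmxA.
congr (_ *m _); apply: (can_inj (mulmxK Pu)).
by rewrite mulmxKV // -mulmxA XP mulKmx.
Qed.

(** A relation and not a function of X: it involves the choice of a Jordan
    basis. That it depends only on the orbit of X is [has_forms_uniq]. *)
Definition has_forms X (Q : quad_tuple k n la) :=
  exists2 P, P \in unitmx & X *m P = P *m N /\
    forall i : 'I_n,
      Q i = isometry_class (qform (leading_form E (model_form P) i.+1.*2)).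

Let even_range (i : 'I_n) : (0 < i.+1.*2 <= n + n)%N.
Proof. by have := ltn_ord i; lia. Qed.

Lemma leading_even_sym Om (i : 'I_n) : skew_wrt N Om -> antisymmx Om ->
  (leading_form E Om i.+1.*2)^T = leading_form E Om i.+1.*2.
Proof.
move=> sk Oma; rewrite (leading_trmx fE sk Oma) //.
by rewrite -signr_odd odd_double scale1r.
Qed.

Lemma has_forms_ex X : sp X -> (exists2 P, P \in unitmx & X *m P = P *m N) ->
  exists2 Q, nondeg_quad_tuples k n la Q & has_forms X Q.
Proof.
move=> Xsp [P Pu XP]; have [sk Oma Ou] := model_formP Xsp Pu XP.
exists (fun i =>
  isometry_class (qform (leading_form E (model_form P) i.+1.*2))).
  move=> i; exists (qform (leading_form E (model_form P) i.+1.*2)) => //.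
  have symB := leading_even_sym i sk Oma; split; first exact: qform_quadratic.
  by apply/nondeg_qform => //; apply: (leading_unitmx fE).
by exists P.
Qed.

(** For even j the leading forms are congruent by hypothesis; for odd j they
    are invertible and antisymmetric of the same size, hence congruent. *)
Lemma has_forms_orbit X X' Q : sp X -> sp X' ->
  has_forms X Q -> has_forms X' Q -> Ad_orbit X X'.
Proof.
move=> Xsp Xsp' [P Pu [XP PQ]] [P' P'u [XP' PQ']].
have [sk Oma Ou] := model_formP Xsp Pu XP.
have [sk' Oma' Ou'] := model_formP Xsp' P'u XP'.
apply/(Ad_orbit_model Pu XP P'u XP').
apply: (leading_congruent_isometry fE) => // j jL; have /andP[j0 jn] := jL.
have [oj|ej] := boolP (odd j).
  have alt Om :
      skew_wrt N Om -> antisymmx Om -> antisymmx (leading_form E Om j).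
    by move=> *; rewrite /antisymmx (leading_trmx fE) // -signr_odd oj scaleN1r.
  apply: (@congruent_trans _ _ _ (std_symplectic k (mult la j))).
    by apply: antisymmx_congruent_std;
      [|exact: alt | exact: (leading_unitmx fE)].
  apply: congruent_sym.
  by apply: antisymmx_congruent_std; [|exact: alt | exact: (leading_unitmx fE)].
have ij : (j./2.-1 < n)%N by lia.
have -> : j = (Ordinal ij).+1.*2 by rewrite /=; lia.
by apply/isometry_class_qform; rewrite -?PQ -?PQ' //; apply: leading_even_sym.
Qed.

Lemma has_forms_uniq X X' Q Q' : sp X -> sp X' ->
  has_forms X Q -> has_forms X' Q' -> Ad_orbit X X' -> Q = Q'.
Proof.
move=> Xsp Xsp' [P Pu [XP PQ]] [P' P'u [XP' PQ']].
have [sk Oma Ou] := model_formP Xsp Pu XP.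
have [sk' Oma' Ou'] := model_formP Xsp' P'u XP'.
move/(Ad_orbit_model Pu XP P'u XP') => [C Cu [CN CJ]].
apply: functional_extensionality_dep => i; rewrite PQ PQ'.
apply/isometry_class_qform => //; try exact: leading_even_sym.
by rewrite -CJ; apply: (leading_congruent fE) => //; rewrite CJ;
  apply: (leading_unitmx fE).
Qed.

(** For odd j the leading form is taken to be the standard symplectic one,
    which exists because the multiplicity of j is even. For the even j that
    are not among 2, ..., 2n any symmetric invertible matrix will do. *)
Lemma has_forms_surj Q : nondeg_quad_tuples k n la Q ->
  exists2 X, sp X & has_forms X Q.
Proof.
move=> Qnd.
have BP : forall j, exists B : 'M[k]_(mult la j),
    [/\ B^T = (-1) ^+ j *: B, B \in unitmx &
      forall (i : 'I_n) (e : j = i.+1.*2),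
        Q i = isometry_class (qform (ecast j 'M[k]_(mult la j) e B))].
  move=> j; have [[i ->]|noti] := pselect (exists i : 'I_n, j = i.+1.*2).
    have [q [qq qnd] Qi] := Qnd i.
    have [S Ssym qE] := quadratic_form_qform two_neq0 qq.
    exists S; split; first by rewrite -signr_odd odd_double scale1r.
      by apply/nondeg_qform => //; rewrite -qE.
    move=> i' e; have ii' : i = i' by apply: val_inj => /=; move: e; lia.
    by subst i'; rewrite (eq_irrelevance e erefl) /= -qE.
  have [oj|ej] := boolP (odd j).
    have [Balt Bu] := std_symplecticP k (hodd oj).
    exists (std_symplectic k (mult la j)); split=> [||i e] //.
      by rewrite Balt -signr_odd oj scaleN1r.
    by case: noti; exists i.
  exists 1%:M; split=> [||i e]; rewrite ?unitmx1 //.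
    by rewrite trmx1 -signr_odd (negPf ej) scale1r.
  by case: noti; exists i.
pose B j := projT1 (cid (BP j)).
have [||Om [sk Oma Ou] OmB] := @leading_realization _ _ _ _ _ _ fE B.
- by move=> j; rewrite /B; case: cid => ? [].
- by move=> j; rewrite /B; case: cid => ? [].
have [P Pu PE] : congruent Om J.
  apply: (congruent_trans (antisymmx_congruent_std two_neq0 Oma Ou)).
  apply/congruent_sym/antisymmx_congruent_std => //; first exact: Jmx_antisym.
  exact: Jmx_unit.
have formP : model_form P = Om.
  rewrite /model_form -PE trmx_inv !mulmxA mulVmx // mul1mx mulmxK //.
  by rewrite unitmx_tr.
exists (P *m N *m invmx P).
  apply/sp_row; rewrite -PE !mulmxA mulmxKV // -(mulmxA P N Om) sk.
  rewrite mulmxN mulNmx !trmx_mul trmx_inv !mulmxA.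
  by rewrite -[_ *m P^T *m invmx P^T]mulmxA mulmxV ?unitmx_tr // mulmx1.
exists P => //; split; first by rewrite mulmxKV.
move=> i; rewrite formP OmB // /B.
by case: cid => S [? ? QS] /=; exact: QS i erefl.
Qed.
End Orbits.

Theorem proposition5p1
  (n : nat) (hn : (2 <= n)%N)
  (k : fieldType) (v : k -> int) (hk : nonarch_local_field v)
  (p : nat) (hp : residual_pchar v p) (p_odd : odd p)
  (hchar : [pchar k] =i pred0 \/
           (p \in [pchar k] /\ (3 * (2 * n - 1) < p)%N))
  (K : closedFieldType) (iota : {rmorphism k -> K})
  (hK : is_algebraic_closure iota)
  (la : seq nat) (hla : is_partition la (2 * n))
  (hodd : forall j : nat, odd j -> ~~ odd (mult la j)) :
  exists f : set 'M[k]_(n + n) -> quad_tuple k n la,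
    set_bij (rational_orbits iota n la) (nondeg_quad_tuples k n la) f.
Proof.
have two_neq0 := two_neq0_of_pchar p_odd hchar.
have la_sum : sumn la = (n + n)%N by case: hla => _ _ ->; rewrite mul2n addnn.
have [N [E [fE typeP]]] := jordan_model iota la_sum.
have modelP X : nilp_orbit la (map_mx iota X) ->
    exists2 P, P \in unitmx & X *m P = P *m N.
  by move=> [_ /typeP]; apply: similar_descent; apply: nonarch_infinite hk.
pose rel O Q := exists2 X, sp X & O = Ad_orbit X /\ has_forms N E X Q.
have relP O : exists Q, rational_orbits iota n la O ->
    nondeg_quad_tuples k n la Q /\ rel O Q.
  have [[X [Xsp Xla] <-]|notO] := pselect (rational_orbits iota n la O).
    have [Q Qnd XQ] := has_forms_ex two_neq0 fE Xsp (modelP X Xla).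
    by exists Q => _; split=> //; exists X.
  by exists (fun=> set0) => /notO.
(* On rational orbits the tuple is unique by [has_forms_uniq], so that [f] does
   not depend on this choice. *)
have [f fP] := choice relP; exists f; split.
- by move=> O /fP[].
- move=> O O' /set_mem/fP[_ [X Xsp [-> XQ]]].
  move=> /set_mem/fP[_ [X' Xsp' [-> XQ']]] ff.
  rewrite ff in XQ; apply: Ad_orbit_eq.
  exact: (has_forms_orbit two_neq0 fE Xsp Xsp' XQ XQ').
- move=> Q Qnd; have [X Xsp XQ] := has_forms_surj two_neq0 fE hodd Qnd.
  have OX : rational_orbits iota n la (Ad_orbit X).
    exists X => //; split=> //; split.
      move: Xsp; rewrite /sp /= => /(congr1 (map_mx iota)).
      have mapJ : map_mx iota (Jmx k n) = Jmx K n.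
        by rewrite /Jmx map_block_mx !map_mx0 map_mxN map_mx1.
      by rewrite map_mxD !map_mxM map_trmx map_mx0 mapJ.
    have [P Pu [XP _]] := XQ; apply/typeP; exists (map_mx iota P).
      by rewrite map_unitmx.
    by rewrite -!map_mxM XP.
  exists (Ad_orbit X) => //; have [_ [X' Xsp' [XX' XQ']]] := fP _ OX.
  apply: (has_forms_uniq two_neq0 fE Xsp' Xsp XQ' XQ).
  by rewrite -XX'; apply: Ad_orbit_refl.
Qed.
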